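(* Let $a_1,a_2>0$ be real numbers, $\Omega=\mathrm{diag}(a_1,a_2)$, and let $T$ be the $\mathcal B$-skew-symmetric matrix $$T=\begin{bmatrix}0&-\sqrt{a_2}/\sqrt{a_1}\\ \sqrt{a_1}/\sqrt{a_2}&0\end{bmatrix}.$$ Then for every $\theta\in\mathbb R$ the matrix exponential satisfies $$R_\theta^{\mathcal B}:=e^{T\theta}=I+(\sin\theta)\,T+(1-\cos\theta)\,T^2=\begin{bmatrix}\cos\theta&-\dfrac{\sqrt{a_2}}{\sqrt{a_1}}\sin\theta\\[2mm] \dfrac{\sqrt{a_1}}{\sqrt{a_2}}\sin\theta&\cos\theta\end{bmatrix},$$ and it gives an elliptical rotation along the ellipse $\lambda a_1x^2+\lambda a_2y^2=1$ for every real $\lambda>0$; that is, $R_\theta^{\mathcal B}$ is an elliptical rotation matrix in the space $\mathbb R^2_{a_1,a_2}$ (so it maps each such ellipse to itself).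
   Context: $\mathbb R^2_{a_1,a_2}$ denotes $\mathbb R^2$ with the elliptical inner product $\mathcal B(\mathbf u,\mathbf w)=a_1u_1w_1+a_2u_2w_2=\mathbf u^t\Omega\mathbf w$. A matrix $T\in\mathbb R^{2\times2}$ is $\mathcal B$-skew-symmetric if $T^t\Omega=-\Omega T$. A matrix $R\in\mathbb R^{2\times 2}$ is an elliptical rotation matrix (or $\mathcal B$-rotation matrix) in $\mathbb R^2_{a_1,a_2}$ if $R^t\Omega R=\Omega$ and $\det R=1$. *)

(* Defs.v *)
From mathcomp Require Import all_boot all_order all_algebra.
From mathcomp Require Import all_classical all_reals all_analysis.
Set Implicit Arguments.
Unset Strict Implicit.
Unset Printing Implicit Defensive.
Import Order.TTheory GRing.Theory Num.Theory.
Import numFieldNormedType.Exports.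
Local Open Scope classical_set_scope.
Local Open Scope ring_scope.

Definition mx2 (R : realType) (a b c d : R) : 'M[R]_2 :=
  \matrix_(i, j) if i == 0 then (if j == 0 then a else b)
                 else (if j == 0 then c else d).

Definition expmx_coeff (R : realType) (n : nat) (A : 'M[R]_n.+1) :
    nat -> 'M[R]_n.+1 :=
  fun k => (k`!%:R)^-1 *: A ^+ k.

(* The limit is taken in the normed (sup-norm) topology of the matrix space;
   as [limn] is total, convergence has to be asserted separately. *)
Definition expmx (R : realType) (n : nat) (A : 'M[R]_n.+1) : 'M[R]_n.+1 :=
  limn (series (expmx_coeff A)).

(* Gram matrix of the inner product B(u, w) = a1 u_1 w_1 + a2 u_2 w_2. *)
Definition Omega (R : realType) (a1 a2 : R) : 'M[R]_2 :=
  diag_mx (\row_(i < 2) if i == 0 then a1 else a2).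

Definition B_skew_symmetric (R : realType) (a1 a2 : R) (T : 'M[R]_2) : Prop :=
  T^T *m Omega a1 a2 = - Omega a1 a2 *m T.

Definition elliptical_rotation_matrix (R : realType) (a1 a2 : R)
    (M : 'M[R]_2) : Prop :=
  M^T *m Omega a1 a2 *m M = Omega a1 a2 /\ \det M = 1.

Definition ellipse (R : realType) (a1 a2 lambda : R) : set 'cV[R]_2 :=
  [set v | lambda * a1 * v 0 0 ^+ 2 + lambda * a2 * v 1 0 ^+ 2 = 1].

Definition skew_gen (R : realType) (a1 a2 : R) : 'M[R]_2 :=
  mx2 0 (- (Num.sqrt a2 / Num.sqrt a1))
      (Num.sqrt a1 / Num.sqrt a2) 0.

Definition rot_B (R : realType) (a1 a2 theta : R) : 'M[R]_2 :=
  expmx (theta *: skew_gen a1 a2).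

(* Main.v *)
(* The generator T satisfies T^2 = -I, so it behaves like the imaginary unit:
   the terms (theta T)^k / k! are those of the cosine series times I for k even
   and those of the sine series times T for k odd. The image of an
   ellipse is handled through its equation lambda v^t Omega v = 1. *)

Require Import Defs.
From mathcomp Require Import all_boot all_order all_algebra.
From mathcomp Require Import all_classical all_reals all_analysis.
From mathcomp Require Import ring.
Set Implicit Arguments.
Unset Strict Implicit.
Unset Printing Implicit Defensive.
Import Order.TTheory GRing.Theory Num.Theory.
Import numFieldNormedType.Exports.
Local Open Scope classical_set_scope.
Local Open Scope ring_scope.

(** Writing k as [odd k] plus twice [k./2], the even part of the power collapses to a sign. *)
Lemma sqrN1_expr_parity (A : pzRingType) (J : A) (k : nat) : J ^+ 2 = -1 ->
  J ^+ k = (-1) ^+ k./2 * (if odd k then J else 1).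
Proof.
move=> J2; rewrite -{1}(odd_double_half k) addnC exprD -mul2n exprM J2.
by case: (odd k); rewrite ?expr1 ?expr0.
Qed.

(** At each index one summand vanishes: [sin_coeff] for even k, [cos_coeff] for odd k. *)
Lemma expmx_coeff_sqrN1 (R : realType) (n : nat) (J : 'M[R]_n.+1) (t : R) :
  J ^+ 2 = -1 ->
  expmx_coeff (t *: J) = (fun k => cos_coeff t k *: 1)
                         + (fun k => sin_coeff t k *: J).
Proof.
move=> J2; apply/funext => k.
rewrite -[RHS]/(cos_coeff t k *: 1 + sin_coeff t k *: J).
rewrite /expmx_coeff /cos_coeff /sin_coeff exprZn (sqrN1_expr_parity k J2) scalerA.
have -> : (-1) ^+ k./2 = ((-1) ^+ k./2)%:A :> 'M[R]_n.+1.
  by rewrite -in_algE rmorphXn rmorphN1.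
rewrite mulr_algl scalerA /=.
have [oddk|evenk] := boolP (odd k); rewrite !mul0r !mul1r scale0r ?add0r ?addr0.
  (* The sign exponent in [sin_coeff] is [k.-1./2], which agrees with [k./2] because k is odd. *)
  congr (_ *: _); case: k oddk => // k /= /negbTE oddk.
  by rewrite uphalf_half oddk add0n; ring.
by congr (_ *: _); rewrite -exprnP; ring.
Qed.

Lemma cvg_series_expmx_sqrN1 (R : realType) (n : nat) (J : 'M[R]_n.+1) (t : R) :
  J ^+ 2 = -1 ->
  series (expmx_coeff (t *: J)) @ \oo --> cos t *: 1 + sin t *: J.
Proof.
(* The partial sums factor as [series u m *: B], and scaling a fixed matrix is continuous, so only
   scalar series remain. *)
have cvgZ_series (u : R^nat) (l : R) (B : 'M[R]_n.+1) :
    series u @ \oo --> l -> series (fun k => u k *: B) @ \oo --> l *: B.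
  move=> ul; rewrite [X in X @ _](_ : _ = fun m => series u m *: B).
    exact: cvgZr_tmp.
  by apply/funext => m; rewrite /series /= scaler_suml.
move=> J2; rewrite expmx_coeff_sqrN1 // seriesD.
apply: cvgD; apply: cvgZ_series.
  (* Unlocking exposes [cos t] as the limit of its own series, so convergence alone suffices. *)
  by rewrite unlock; exact: is_cvg_series_cos_coeff.
by rewrite unlock; exact: is_cvg_series_sin_coeff.
Qed.

Lemma expmx_sqrN1 (R : realType) (n : nat) (J : 'M[R]_n.+1) (t : R) :
  J ^+ 2 = -1 -> expmx (t *: J) = cos t *: 1 + sin t *: J.
Proof.
move=> J2; apply: cvg_lim; first exact: norm_hausdorff.
exact: cvg_series_expmx_sqrN1.
Qed.

Lemma matrix2P (T : Type) (A B : 'M[T]_2) :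
  A 0 0 = B 0 0 -> A 0 1 = B 0 1 -> A 1 0 = B 1 0 -> A 1 1 = B 1 1 -> A = B.
Proof.
move=> h00 h01 h10 h11; apply/matrixP.
suff ord2 (i : 'I_2) : i = 0 \/ i = 1 by move=> i j; case: (ord2 i) (ord2 j) => -> [] ->.
by case: i => [[|[|//]] lti]; [left|right]; apply: val_inj.
Qed.

Lemma mul_mx2 (R : realType) (a b c d a' b' c' d' : R) :
  mx2 a b c d *m mx2 a' b' c' d' =
  mx2 (a * a' + b * c') (a * b' + b * d') (c * a' + d * c') (c * b' + d * d').
Proof. by apply: matrix2P; rewrite !mxE !big_ord_recl big_ord0 !mxE /= addr0. Qed.

Lemma tr_mx2 (R : realType) (a b c d : R) : (mx2 a b c d)^T = mx2 a c b d.
Proof. by apply: matrix2P; rewrite !mxE. Qed.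

Lemma det_mx2 (R : realType) (a b c d : R) : \det (mx2 a b c d) = a * d - b * c.
Proof.
rewrite (expand_det_row _ 0) !big_ord_recl big_ord0 /cofactor !det_mx11 !mxE /=.
by rewrite expr0 expr1; ring.
Qed.

Lemma Omega_mx2 (R : realType) (a1 a2 : R) : Omega a1 a2 = mx2 a1 0 0 a2.
Proof. by apply: matrix2P; rewrite !mxE. Qed.

(** In this matrix form the invariance of [Omega] under M applies directly. *)
Lemma ellipseE (R : realType) (a1 a2 lambda : R) (v : 'cV[R]_2) :
  ellipse a1 a2 lambda v <-> lambda * (v^T *m Omega a1 a2 *m v) 0 0 = 1.
Proof.
rewrite Omega_mx2 /ellipse /= !mxE !big_ord_recl !big_ord0 !mxE.
rewrite !big_ord_recl !big_ord0 !mxE /=.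
have -> : lift ord0 ord0 = 1 :> 'I_2 by apply: val_inj.
have -> : ord0 = 0 :> 'I_2 by [].
by split=> <-; ring.
Qed.

(** Supplies preimages on the ellipse. Replacing the inner [Omega] by its conjugate under M makes
    the inverses cancel. *)
Lemma elliptical_rotation_matrixV (R : realType) (a1 a2 : R) (M : 'M[R]_2) :
  elliptical_rotation_matrix a1 a2 M -> elliptical_rotation_matrix a1 a2 (invmx M).
Proof.
move=> [MO detM]; have uM : M \in unitmx by rewrite unitmxE detM unitr1.
split; last by rewrite det_inv detM invr1.
by rewrite -{1}MO !mulmxA -trmx_mul mulmxV // trmx1 mul1mx mulmxK.
Qed.

Lemma elliptical_rotation_ellipse_sub (R : realType) (a1 a2 lambda : R)
    (M : 'M[R]_2) : elliptical_rotation_matrix a1 a2 M ->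
  forall v, ellipse a1 a2 lambda v -> ellipse a1 a2 lambda (M *m v).
Proof.
move=> [MO _] v /ellipseE vE; apply/ellipseE; rewrite -{}vE trmx_mul.
by rewrite -[in RHS]MO !mulmxA.
Qed.

Lemma elliptical_rotation_ellipse (R : realType) (a1 a2 lambda : R)
    (M : 'M[R]_2) : elliptical_rotation_matrix a1 a2 M ->
  [set M *m v | v in ellipse a1 a2 lambda] = ellipse a1 a2 lambda.
Proof.
move=> rotM; apply/seteqP; split=> [_ [v vE <-]|v vE].
  exact: elliptical_rotation_ellipse_sub.
(* The preimage of v lies on the ellipse because the inverse is an elliptical rotation too. *)
exists (invmx M *m v); last by rewrite mulKVmx // unitmxE rotM.2 unitr1.
exact/elliptical_rotation_ellipse_sub/vE/elliptical_rotation_matrixV.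
Qed.

Section SkewGenerator.
Variables (R : realType) (a1 a2 : R).
Hypotheses (ha1 : 0 < a1) (ha2 : 0 < a2).
Let p := Num.sqrt a2 / Num.sqrt a1.
Let q := Num.sqrt a1 / Num.sqrt a2.

(** This relation yields T^2 = -I. *)
Let pq1 : p * q = 1.
Proof. by rewrite /p /q; field; rewrite !lt0r_neq0 ?sqrtr_gt0. Qed.

(** Both sides equal the product of the square roots of [a1] and [a2]; this is what makes T skew for
    B. *)
Let a1p : a1 * p = a2 * q.
Proof.
rewrite -{1}(sqr_sqrtr (ltW ha1)) -{1}(sqr_sqrtr (ltW ha2)) /p /q.
by field; rewrite !lt0r_neq0 ?sqrtr_gt0.
Qed.

Lemma skew_gen_skew : B_skew_symmetric a1 a2 (skew_gen a1 a2).
Proof.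
rewrite /B_skew_symmetric /skew_gen -/p -/q Omega_mx2 tr_mx2 mulNmx !mul_mx2.
by apply: matrix2P; rewrite !mxE /=; ring: a1p.
Qed.

Lemma sqr_skew_gen : skew_gen a1 a2 ^+ 2 = -1.
Proof.
rewrite expr2 -[LHS]/(_ *m _) /skew_gen -/p -/q mul_mx2.
by apply: matrix2P; rewrite !mxE /=; ring: pq1.
Qed.

Lemma rot_BE (t : R) :
  rot_B a1 a2 t = mx2 (cos t) (- (p * sin t)) (q * sin t) (cos t).
Proof.
rewrite /rot_B expmx_sqrN1 ?sqr_skew_gen // /skew_gen -/p -/q.
by apply: matrix2P; rewrite !mxE /=; ring.
Qed.

Lemma rot_B_elliptical_rotation (t : R) :
  elliptical_rotation_matrix a1 a2 (rot_B a1 a2 t).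
Proof.
have cs : cos t ^+ 2 = 1 - sin t ^+ 2 by rewrite -(cos2Dsin2 t) addrK.
rewrite rot_BE; split; last by rewrite det_mx2; ring: pq1 cs.
rewrite Omega_mx2 tr_mx2 !mul_mx2; congr mx2.
(* The weight of the squared sine becomes [a1], so the diagonal entry reduces to the Pythagorean
   identity; the other diagonal entry is symmetric. *)
- have aqq : a2 * q * q = a1 by rewrite -a1p -mulrA pq1 mulr1.
  by ring: aqq cs.
- by ring: a1p.
- by ring: a1p.
- have app : a1 * p * p = a2 by rewrite a1p -mulrA [q * p]mulrC pq1 mulr1.
  by ring: app cs.
Qed.

End SkewGenerator.

Theorem theorem1 (R : realType) (a1 a2 : R) (ha1 : 0 < a1) (ha2 : 0 < a2) :
  B_skew_symmetric a1 a2 (skew_gen a1 a2) /\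
  forall theta : R,
    [/\ cvgn (series (expmx_coeff (theta *: skew_gen a1 a2))),
        rot_B a1 a2 theta =
          1%:M + sin theta *: skew_gen a1 a2
               + (1 - cos theta) *: (skew_gen a1 a2) ^+ 2,
        rot_B a1 a2 theta =
          mx2 (cos theta) (- (Num.sqrt a2 / Num.sqrt a1 * sin theta))
              (Num.sqrt a1 / Num.sqrt a2 * sin theta) (cos theta),
        elliptical_rotation_matrix a1 a2 (rot_B a1 a2 theta) &
        forall lambda : R, 0 < lambda ->
          [set rot_B a1 a2 theta *m v | v in ellipse a1 a2 lambda]
            = ellipse a1 a2 lambda].
Proof.
split=> [|t]; first exact: skew_gen_skew.
have T2 := sqr_skew_gen ha1 ha2.
have rotT := rot_B_elliptical_rotation ha1 ha2 t.
split=> //.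
- by apply/cvg_ex; eexists; exact: cvg_series_expmx_sqrN1.
(* With T^2 = -I the last term is (cos t - 1) I, which cancels the leading I and leaves cos t I +
   sin t T. *)
- rewrite /rot_B expmx_sqrN1 // T2 scalerN -[1%:M]/1 scalerBl scale1r.
  by rewrite opprB addrAC addrCA subrr addr0.
- exact: rot_BE.
- by move=> lambda _; exact: elliptical_rotation_ellipse.
Qed.
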